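(* Let $\mathcal{S} \subset \mathbb{R}^p$, let $\mathbf{x}^\ast \in \mathcal{S}$, and let $\mathcal{C} \subseteq \mathbb{R}^p$ be a closed convex set (not necessarily containing $\mathbf{x}^\ast$). Let $\sigma > 0$, $n \geq 1$, and let $\mathbf{y}_1,\dots,\mathbf{y}_n$ be independent observations of $\mathbf{y} = \mathbf{x}^\ast + \sigma \mathbf{z}$ with $\mathbf{z} \sim \mathcal{N}(0, I_{p\times p})$. Let $\bar{\mathbf{y}} = \frac{1}{n}\sum_{i=1}^n \mathbf{y}_i$ and let $\hat{\mathbf{x}}_n(\mathcal{C}) = \arg\min_{\mathbf{x} \in \mathcal{C}} \frac12 \|\bar{\mathbf{y}} - \mathbf{x}\|_{\ell_2}^2$. Suppose there exists a point $\tilde{\mathbf{x}} \in \mathcal{C}$ such that $\mathcal{C} - \tilde{\mathbf{x}} = Q_1 \oplus Q_2$, where $Q_1, Q_2$ lie in orthogonal subspaces of $\mathbb{R}^p$ and $Q_2 \subseteq \alpha B^p_{\ell_2}$ for some $\alpha \geq 0$. Then $$\mathbb{E}\left[\|\mathbf{x}^\ast - \hat{\mathbf{x}}_n(\mathcal{C})\|_{\ell_2}^2\right] \leq 6\left[\frac{\sigma^2}{n}\, g\big(\mathrm{cone}(Q_1) \cap B^p_{\ell_2}\big) + \|\mathbf{x}^\ast - \tilde{\mathbf{x}}\|_{\ell_2}^2 + \alpha^2\right].$$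
   Context: $B^p_{\ell_2}$ is the closed unit Euclidean ball in $\mathbb{R}^p$. $\mathcal{C} - \tilde{\mathbf{x}} = \{\mathbf{c} - \tilde{\mathbf{x}} : \mathbf{c} \in \mathcal{C}\}$, and $Q_1 \oplus Q_2 = \{\mathbf{q}_1 + \mathbf{q}_2 : \mathbf{q}_1 \in Q_1, \mathbf{q}_2 \in Q_2\}$ where $Q_1 \subseteq R_1$, $Q_2 \subseteq R_2$ for orthogonal linear subspaces $R_1, R_2$ of $\mathbb{R}^p$. $\mathrm{cone}(Q_1)$ is the conic hull of $Q_1$ (the set of all nonnegative linear combinations of elements of $Q_1$). The Gaussian squared-complexity of a set $\mathcal{D} \subseteq \mathbb{R}^p$ is $g(\mathcal{D}) = \mathbb{E}\big[\big(\sup_{\mathbf{a} \in \mathcal{D}} \langle \mathbf{a}, \mathbf{g}\rangle\big)^2\big]$, where the expectation is over $\mathbf{g} \sim \mathcal{N}(0, I_{p\times p})$. *)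

(* Defs.v *)
From HB Require Import structures.
From mathcomp Require Import all_boot all_order all_algebra.
From mathcomp Require Import all_classical all_reals all_analysis.

Set Implicit Arguments.
Unset Strict Implicit.
Unset Printing Implicit Defensive.

Import Order.TTheory GRing.Theory Num.Theory.
Import numFieldNormedType.Exports.

Local Open Scope classical_set_scope.
Local Open Scope ring_scope.

(* [R^p] is ['rV[R]_p]. Its library norm is the sup norm, hence the Euclidean
   structure below; the two norms induce the same topology. *)
Section euclidean.
Context {R : realType} {p : nat}.
Implicit Types (u v x y : 'rV[R]_p) (A Q : set 'rV[R]_p).

Definition dotv u v : R := \sum_(i < p) u 0 i * v 0 i.

Definition enorm u : R := Num.sqrt (dotv u u).

Definition unit_ball : set 'rV[R]_p := [set u | enorm u <= 1].

Definition convex_subset A := convex_set (A : set (convex_lmodType 'rV[R]_p)).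

Definition conic_hull Q : set 'rV[R]_p :=
  [set x | exists (k : nat) (c : 'I_k -> R) (q : 'I_k -> 'rV[R]_p),
    [/\ forall i, 0 <= c i, forall i, Q (q i) & x = \sum_(i < k) c i *: q i]].

Definition orthogonal_subspaces (V W : {vspace 'rV[R]_p}) :=
  forall v w, v \in V -> w \in W -> dotv v w = 0.

(* Defaults to [0] if [f] has no minimiser on [A]; for [A] nonempty, closed and
   convex and [f x = 2^-1 * enorm (y - x) ^+ 2] the minimiser is unique. *)
Definition argmin A (f : 'rV[R]_p -> R) : 'rV[R]_p :=
  xget 0 [set x | A x /\ forall u, A u -> f x <= f u].

(* Least-squares estimate over [A] from the data vector [y]. *)
Definition constrained_lse A y : 'rV[R]_p :=
  argmin A (fun x => 2^-1 * enorm (y - x) ^+ 2).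

End euclidean.

(* Product sigma-algebra, as the library does for ['n.-tuple T]; on ['rV[R]_p]
   it is the Borel sigma-algebra. *)
Section measurable_row.
Context {d} {T : sigmaRingType d}.
Variable n : nat.

Definition row_coord (i : 'I_n) (x : 'rV[T]_n) : T := x ord0 i.

Let row_set0 : g_sigma_preimage row_coord set0.
Proof. exact: sigma_algebra0. Qed.

Let row_setC A : g_sigma_preimage row_coord A ->
  g_sigma_preimage row_coord (~` A).
Proof. exact: sigma_algebraC. Qed.

Let row_bigcup (F : _^nat) : (forall i, g_sigma_preimage row_coord (F i)) ->
  g_sigma_preimage row_coord (\bigcup_i (F i)).
Proof. exact: sigma_algebra_bigcup. Qed.

HB.instance Definition _ := @isMeasurable.Build (measure_tuple_display d)
  'rV[T]_n (g_sigma_preimage row_coord) row_set0 row_setC row_bigcup.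

End measurable_row.

Lemma measurable_row_coord d (T : sigmaRingType d) n (i : 'I_n) :
  measurable_fun [set: 'rV[T]_n] (row_coord i).
Proof.
move=> _ Y mY; rewrite setTI; apply: sub_sigma_algebra => /=.
rewrite -bigcup_seq/=; exists i => /=; first by rewrite mem_index_enum.
by exists Y => //; rewrite setTI.
Qed.

Lemma measurable_fun_rowP d1 d2 (T1 : measurableType d1)
    (T2 : measurableType d2) n (f : T1 -> 'rV[T2]_n) :
  (forall i, measurable_fun [set: T1] (row_coord i \o f)) ->
  measurable_fun [set: T1] f.
Proof.
move=> mf _ A mA; rewrite setTI.
suff : @measurable _ 'rV[T2]_n `<=` [set B | measurable (f @^-1` B)] by apply.
apply: smallest_sub => [|B].
  split => [|B mB|F mF] /=.
  - by rewrite preimage_set0.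
  - by rewrite setTD preimage_setC; exact: measurableC.
  - by rewrite preimage_bigcup; apply: bigcup_measurable => k _; exact: mF.
rewrite -bigcup_seq/= => -[i _ [C mC <-]].
by have := mf i measurableT _ mC; rewrite !setTI.
Qed.

Section standard_gaussian.
Context {R : realType}.

Definition row_cons n (x : measurableTypeR R * 'rV[R]_n) : 'rV[R]_n.+1 :=
  \row_i (if unlift ord0 i is Some j then x.2 ord0 j else x.1).

Lemma measurable_row_cons n : measurable_fun setT (@row_cons n).
Proof.
apply: measurable_fun_rowP => i; case: (unliftP ord0 i) => [j|] ->.
  apply: (eq_measurable_fun (row_coord j \o snd)) => [x _|].
    by rewrite /= /row_coord mxE liftK.
  by apply: measurableT_comp => //; exact: measurable_row_coord.
apply: (eq_measurable_fun fst) => [x _|]; last exact: measurable_fst.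
by rewrite /= /row_coord mxE unlift_none.
Qed.

HB.instance Definition _ n :=
  isMeasurableFun.Build _ _ _ _ (@row_cons n) (@measurable_row_cons n).

(* [N(0, I_n)], as the [n]-fold product of [N(0, 1)]; see [std_gaussianE]. *)
Fixpoint std_gaussian n : probability 'rV[R]_n R :=
  match n with
  | 0 => \d_(0 : 'rV[R]_0)
  | n'.+1 => distribution (normal_prob 0 1 \x std_gaussian n')%E (@row_cons n')
  end.

Lemma std_gaussianE n (A : 'I_n -> set (measurableTypeR R)) :
  (forall i, measurable (A i)) ->
  std_gaussian n [set x | forall i, A i (x ord0 i)] =
  (\prod_(i < n) normal_prob 0 1 (A i))%E.
Proof.
elim: n A => [|n IH] A mA /=.
  rewrite big_ord0 diracE mem_set//= => i; by case: i.
rewrite big_ord_recl -IH; last by move=> i; exact: mA.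
have mB : measurable
    [set x : 'rV[R]_n | forall i, A (lift ord0 i) (x ord0 i)].
  rewrite (_ : [set _ | _] = \bigcap_(i in setT)
    (row_coord i @^-1` A (lift ord0 i) : set 'rV[R]_n)).
    apply: fin_bigcap_measurable => //= i _.
    rewrite -[_ @^-1` _]setTI; apply: measurable_row_coord => //; exact: mA.
  by apply/seteqP; split => [x Ax i _|x Ax i]; exact: Ax.
rewrite -product_measure1E// /distribution /pushforward; congr (_ _).
apply/seteqP; split => [[a v] /= Aav|[a v] /= [Aa Av] i].
  split=> [|i]; first by have := Aav ord0; rewrite mxE unlift_none.
  by have := Aav (lift ord0 i); rewrite mxE liftK.
by rewrite mxE; case: (unliftP ord0 i) => [j|] ->.
Qed.

Local Open Scope ereal_scope.

Definition gaussian_sq_complexity p (D : set 'rV[R]_p) : \bar R :=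
  \int[std_gaussian p]_g (ereal_sup [set (dotv a g)%:E | a in D]) ^+ 2.

End standard_gaussian.

Section observations.
Context {d} {T : measurableType d} {R : realType} (P : probability T R).

Definition mutually_independent d' (T' : measurableType d') (I : finType)
    (X : I -> {RV P >-> T'}) :=
  forall (J : {set I}) (A : I -> set T'), (forall i, measurable (A i)) ->
    P (\bigcap_(i in [set` J]) X i @^-1` A i) =
    (\prod_(i in J) P (X i @^-1` A i))%E.

(* [Y] has the law of [m + sigma *: z] where [z] has law [N(0, I_p)]. *)
Definition gaussian_observation p (m : 'rV[R]_p) (sigma : R)
    (Y : {RV P >-> 'rV[R]_p}) :=
  forall A : set 'rV[R]_p, measurable A ->
    distribution P Y A =
    pushforward (std_gaussian p) (fun z : 'rV[R]_p => m + sigma *: z) A.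

Definition sample_mean p n (Y : 'I_n -> {RV P >-> 'rV[R]_p}) (t : T) :
    'rV[R]_p :=
  n%:R^-1 *: \sum_(i < n) Y i t.

End observations.

(* Main.v *)
(* Write w = x* - xt, and v = ybar - xt = w + s g with s = sigma / sqrt n and g
   standard Gaussian. The projection of v on C - xt is q1 + q2 with q1 in Q1, q2
   in Q2. Since 0 lies in Q1, the variational inequality at the competitor q2
   gives |q1|^2 <= <v, q1>, hence |q1| <= |w| + s G(g) where G(g) is the supremum
   of <., g> over cone(Q1) and the unit ball, while |q2| <= alpha. So
   |w - q1 - q2|^2 <= 2 |w|^2 + 2 (|q1|^2 + |q2|^2)
                   <= 6 (s^2 G(g)^2 + |w|^2 + alpha^2).
   That g is standard Gaussian follows by adding the observations one at a time,
   the one-dimensional convolution of normal laws being a completion of the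
   square. *)
From HB Require Import structures.
Require Import Defs.
From mathcomp Require Import all_boot all_order all_algebra.
From mathcomp Require Import all_classical all_reals all_analysis.
From mathcomp Require Import measurable_realfun ring lra.

Import Order.TTheory GRing.Theory Num.Theory.
Import numFieldNormedType.Exports.

Local Open Scope classical_set_scope.
Local Open Scope ring_scope.

(** * Euclidean geometry of rows and projection onto a closed convex set *)

Section dot_product.
Context {R : realType} {p : nat}.
Implicit Types (u v w x y : 'rV[R]_p) (a : R).

Lemma dotvC u v : dotv u v = dotv v u.
Proof. by apply: eq_bigr => i _; rewrite mulrC. Qed.

Lemma dotvDl u v w : dotv (u + v) w = dotv u w + dotv v w.
Proof. by rewrite -big_split; apply: eq_bigr => i _; rewrite mxE mulrDl. Qed.

Lemma dotvZl a u v : dotv (a *: u) v = a * dotv u v.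
Proof. by rewrite mulr_sumr; apply: eq_bigr => i _; rewrite mxE mulrA. Qed.

Lemma dotvNl u v : dotv (- u) v = - dotv u v.
Proof. by rewrite -scaleN1r dotvZl mulN1r. Qed.

Lemma dotvBl u v w : dotv (u - v) w = dotv u w - dotv v w.
Proof. by rewrite dotvDl dotvNl. Qed.

Lemma dotvDr u v w : dotv w (u + v) = dotv w u + dotv w v.
Proof. by rewrite dotvC dotvDl !(dotvC w). Qed.

Lemma dotvZr a u v : dotv v (a *: u) = a * dotv v u.
Proof. by rewrite dotvC dotvZl dotvC. Qed.

Lemma dotvNr u v : dotv v (- u) = - dotv v u.
Proof. by rewrite dotvC dotvNl dotvC. Qed.

Lemma dotvBr u v w : dotv w (u - v) = dotv w u - dotv w v.
Proof. by rewrite dotvDr dotvNr. Qed.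

Lemma dot0v u : dotv 0 u = 0.
Proof. by rewrite -(scale0r 0) dotvZl mul0r. Qed.

Lemma dotv_ge0 u : 0 <= dotv u u.
Proof. by apply: sumr_ge0 => i _; rewrite -expr2 sqr_ge0. Qed.

Lemma dotv_eq0 u : (dotv u u == 0) = (u == 0).
Proof.
apply/eqP/eqP => [u0|->]; last exact: dot0v.
apply/rowP => i; rewrite mxE; apply/eqP; rewrite -sqrf_eq0 expr2.
move/eqP: u0; rewrite psumr_eq0; last by move=> j _; rewrite -expr2 sqr_ge0.
by move=> /allP/(_ i (mem_index_enum i)).
Qed.

Lemma enorm_ge0 u : 0 <= enorm u.
Proof. exact: sqrtr_ge0. Qed.

Lemma sqr_enorm u : enorm u ^+ 2 = dotv u u.
Proof. by rewrite sqr_sqrtr ?dotv_ge0. Qed.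

Lemma enorm_eq0 u : (enorm u == 0) = (u == 0).
Proof. by rewrite -dotv_eq0 -sqr_enorm sqrf_eq0. Qed.

Lemma enormZ a u : enorm (a *: u) = `|a| * enorm u.
Proof.
by rewrite /enorm dotvZl dotvZr mulrA -expr2 sqrtrM ?sqr_ge0// sqrtr_sqr.
Qed.

(** At [u = 0] the scaled vector is 0, which also lies in the ball. *)
Lemma enorm_unit_ball u : unit_ball ((enorm u)^-1 *: u).
Proof.
rewrite /unit_ball /= enormZ ger0_norm ?invr_ge0 ?enorm_ge0//.
by have [->|u0] := eqVneq (enorm u) 0; [rewrite mulr0 ler01|rewrite mulVf].
Qed.

(** Cauchy-Schwarz: the squared norm of [dotv v v *: u - dotv u v *: v] is [dotv v v] times the
    difference of the two sides. *)
Lemma sqr_dotv_le u v : dotv u v ^+ 2 <= dotv u u * dotv v v.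
Proof.
have [/eqP|v0] := eqVneq (dotv v v) 0.
  by rewrite dotv_eq0 => /eqP ->; rewrite dotvC !dot0v expr0n mulr0.
have v_gt0 : 0 < dotv v v by rewrite lt_neqAle eq_sym v0 dotv_ge0.
have := dotv_ge0 (dotv v v *: u - dotv u v *: v).
rewrite dotvBl !dotvBr !dotvZl !dotvZr (dotvC v u) => h.
have : 0 <= dotv v v * (dotv u u * dotv v v - dotv u v ^+ 2) by nra.
by rewrite pmulr_rge0// subr_ge0.
Qed.

Lemma dotv_le_enorm u v : dotv u v <= enorm u * enorm v.
Proof.
rewrite -sqrtrM ?dotv_ge0// (le_trans (ler_norm _))//.
by rewrite -sqrtr_sqr ler_wsqrtr// sqr_dotv_le.
Qed.

(** Parallelogram identity: the gap between the two sides is the squared norm of [u + v]. *)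
Lemma sqr_enormB_le u v :
  enorm (u - v) ^+ 2 <= 2 * enorm u ^+ 2 + 2 * enorm v ^+ 2.
Proof.
have := dotv_ge0 (u + v).
by rewrite !sqr_enorm !(dotvDl, dotvDr, dotvNl, dotvNr) (dotvC v u); lra.
Qed.

Lemma ler_coord_enorm u (i : 'I_p) : `|u 0 i| <= enorm u.
Proof.
rewrite -sqrtr_sqr ler_wsqrtr// /dotv (bigD1 i)//= -expr2 lerDl sumr_ge0// => k _.
by rewrite -expr2 sqr_ge0.
Qed.

Lemma continuous_dotvl u : continuous (fun x => dotv x u).
Proof.
apply: continuous_big => [|i _ x]; first exact: add_continuous.
by apply: (@continuousM _ _ (fun x => x 0 i) (cst (u 0 i)));
  [exact: coord_continuous|exact: cst_continuous].
Qed.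

Lemma continuous_enormB y : continuous (fun x => enorm (y - x)).
Proof.
move=> x; apply: (@continuous_comp _ _ _ (fun x => dotv (y - x) (y - x)) Num.sqrt).
  move: x; apply: continuous_big => [|i _ x]; first exact: add_continuous.
  have h : {for x, continuous (fun x : 'rV[R]_p => (y - x) 0 i)}.
    have -> : (fun x : 'rV[R]_p => (y - x) 0 i) = (fun x => y 0 i - x 0 i).
      by apply/funext => z; rewrite !mxE.
    by apply: (@continuousB _ R^o); [exact: cst_continuous|exact: coord_continuous].
  exact: (continuousM h h).
exact: sqrt_continuous.
Qed.

(** A minimiser exists because the search can be confined to a compact part of [C]: points farther
    from [y] than a fixed [c] in [C] cannot compete. *)
Lemma constrained_lseP (C : set 'rV[R]_p) y : closed C -> C !=set0 ->
  C (constrained_lse C y) /\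
  forall u, C u -> enorm (y - constrained_lse C y) ^+ 2 <= enorm (y - u) ^+ 2.
Proof.
move=> cC [c Cc].
(* A box around the Euclidean ball centred at [y] through [c]. It is compact as a product of
   segments. *)
pose B := [set x : 'rV[R]_p | forall i,
  [set` `[y 0 i - enorm (y - c), y 0 i + enorm (y - c)]] (x 0 i)].
have inB x : enorm (y - x) <= enorm (y - c) -> B x.
  move=> xc i; have := le_trans (ler_coord_enorm (y - x) i) xc.
  by rewrite /= in_itv/= !mxE ler_norml => /andP[? ?]; apply/andP; split; lra.
have cB : compact (C `&` B).
  rewrite setIC; apply: compact_closedI => //.
  apply: (@rV_compact _ _ (fun i =>
    `[y 0 i - enorm (y - c), y 0 i + enorm (y - c)]%classic)) => i.
  exact: segment_compact.
have [|m /set_mem[Cm _] mP] :=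
  EVT_min_rV _ cB (continuous_subspaceT (@continuous_enormB y)).
  by exists c; split => //; exact: inB.
have {}mP u : C u -> enorm (y - m) <= enorm (y - u).
  move=> Cu; have [uc|/ltW cu] := leP (enorm (y - u)) (enorm (y - c)).
    by apply: mP; rewrite inE; split => //; exact: inB.
  by rewrite (le_trans _ cu)// mP// inE; split => //; exact: inB.
(* With a minimiser at hand, [xget] in [argmin] does not fall back on its default 0. *)
have : exists x, C x /\ forall u, C u ->
    2^-1 * enorm (y - x) ^+ 2 <= 2^-1 * enorm (y - u) ^+ 2.
  by exists m; split => // u /mP mu; rewrite ler_pM2l ?invr_gt0//
    ler_sqr ?nnegrE ?enorm_ge0.
rewrite /constrained_lse /argmin => /(xgetPex 0)[Cx xP]; split => // u /xP.
by rewrite ler_pM2l ?invr_gt0.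
Qed.

(** Comparing the projection [h] with the points [t *: u + (1 - t) *: h] of the segment gives an
    inequality between a linear and a quadratic term in [t], which fails for a small [t > 0] if the
    inner product is positive. *)
Lemma constrained_lse_variational (C : set 'rV[R]_p) y u :
  closed C -> convex_subset C -> C u ->
  dotv (y - constrained_lse C y) (u - constrained_lse C y) <= 0.
Proof.
move=> cC cvC Cu; set h := constrained_lse C y.
have [Ch hP] : C h /\ forall v, C v -> enorm (y - h) ^+ 2 <= enorm (y - v) ^+ 2.
  by apply: constrained_lseP => //; exists u.
have quad t : 0 <= t <= 1 ->
    2 * dotv (y - h) (u - h) * t <= dotv (u - h) (u - h) * t ^+ 2.
  move=> t01; have [t0 t1] := andP t01.
  pose l := Itv01 t0 t1.
  have : C (t *: u + (1 - t) *: h).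
    have := cvC u h l; rewrite !inE; apply=> //.
  move=> /hP; have -> : y - (t *: u + (1 - t) *: h) = (y - h) - t *: (u - h).
    by apply/rowP => i; rewrite !mxE; ring.
  move: (y - h) (u - h) => v w.
  rewrite !sqr_enorm dotvBl !dotvBr !dotvZl !dotvZr (dotvC w v) => hP'; nra.
rewrite leNgt; apply/negP => d_gt0.
set d := dotv (y - h) _ in quad d_gt0; set e := dotv _ _ in quad.
have e0 : 0 <= e by exact: dotv_ge0.
have de : 0 < d + e by rewrite ltr_wpDr.
(* For [t = d / (d + e)] one has [t * e <= d], whereas [quad] would give [2 * d <= t * e]. This [t]
   stays in the unit interval and makes sense even if [e = 0]. *)
have t01 : 0 <= d / (d + e) <= 1.
  by rewrite divr_ge0 ?(ltW d_gt0) ?(ltW de)//= ler_pdivrMr// mul1r lerDl.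
have {quad} := quad _ t01.
have : (d / (d + e)) * (d + e) = d by rewrite divfK ?gt_eqF.
have : 0 < d / (d + e) by rewrite divr_gt0.
move: (d / (d + e)) => t t0 td; nra.
Qed.

End dot_product.

(** * The error bound for a fixed noise vector *)

Section deterministic_bound.
Context {R : realType} {p : nat}.
Implicit Types (Q : set 'rV[R]_p) (q g : 'rV[R]_p).

Lemma conic_hull0 Q : conic_hull Q 0.
Proof.
by exists 0, (fun=> 0), (fun=> 0); split; [case|case|rewrite big_ord0].
Qed.

Lemma conic_hullZ Q a q : 0 <= a -> Q q -> conic_hull Q (a *: q).
Proof.
by move=> a0 Qq; exists 1, (fun=> a), (fun=> q); split; rewrite ?big_ord1.
Qed.

Lemma unit_ball0 : unit_ball (0 : 'rV[R]_p).
Proof. by have := enorm_unit_ball (0 : 'rV[R]_p); rewrite scaler0. Qed.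

(** The pathwise estimate, with [g] a fixed vector and [G] any real upper bound; the supremum over
    the truncated cone is substituted for [G] later. *)
Lemma constrained_lse_bound (C Q1 Q2 : set 'rV[R]_p)
    (R1 R2 : {vspace 'rV[R]_p}) (xstar xtilde g : 'rV[R]_p) (s G alpha : R) :
  closed C -> convex_subset C -> C xtilde -> orthogonal_subspaces R1 R2 ->
  Q1 `<=` [set` R1] -> Q2 `<=` [set` R2] ->
  [set c - xtilde | c in C] = [set q1 + q2 | q1 in Q1 & q2 in Q2] ->
  0 <= alpha -> Q2 `<=` [set alpha *: u | u in unit_ball] -> 0 <= s ->
  (forall a, (conic_hull Q1 `&` unit_ball) a -> dotv a g <= G) ->
  enorm (xstar - constrained_lse C (xstar + s *: g)) ^+ 2 <=
    6 * (s ^+ 2 * G ^+ 2 + enorm (xstar - xtilde) ^+ 2 + alpha ^+ 2).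
Proof.
move=> cC cvC Cxt R12 Q1R Q2R CQ alpha0 Q2a s0 GP.
set y := xstar + s *: g; set h := constrained_lse C y.
have orth q1 q2 : Q1 q1 -> Q2 q2 -> dotv q1 q2 = 0.
  by move=> /Q1R ? /Q2R ?; exact: R12.
have [q1 Q1q1 [q2 Q2q2 hE]] : [set q1 + q2 | q1 in Q1 & q2 in Q2] (h - xtilde).
  by rewrite -CQ; exists h => //;
    have [] := constrained_lseP C y cC (ex_intro _ xtilde Cxt).
(* As [xtilde] is in [C], [0 = a + b] with [a] in [Q1] and [b] in [Q2]; then [a = - b] is orthogonal
   to itself, so [a = 0]. *)
have Q10 : Q1 0.
  have : [set c - xtilde | c in C] 0 by exists xtilde => //; rewrite subrr.
  rewrite CQ => -[a Q1a [b Q2b /eqP]]; rewrite addr_eq0 => /eqP ab.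
  suff /eqP <- : a == 0 by [].
  by rewrite -dotv_eq0 {2}ab dotvNr orth// oppr0.
have Cu : C (xtilde + q2).
  have : [set c - xtilde | c in C] q2.
    by rewrite CQ; exists 0 => //; exists q2 => //; rewrite add0r.
  by case=> c Cc <-; rewrite addrC subrK.
have := constrained_lse_variational C y _ cC cvC Cu; rewrite -/h.
set w := xstar - xtilde.
have -> : xtilde + q2 - h = - q1.
  by rewrite -(subrK xtilde h) -hE; apply/rowP => i; rewrite !mxE; ring.
have -> : y - h = w + s *: g - q1 - q2.
  by rewrite -(subrK xtilde h) -hE /y /w; apply/rowP => i; rewrite !mxE; ring.
have -> : xstar - h = w - (q1 + q2).
  by rewrite hE /w; apply/rowP => i; rewrite !mxE; ring.
rewrite dotvNr !dotvBl dotvDl dotvZl (dotvC q2) (orth q1 q2)// subr0 oppr_le0.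
have G0 : 0 <= G by rewrite -(dot0v g) GP//; split;
  [exact: conic_hull0|exact: unit_ball0].
(* The normalised [q1] lies in the cone and in the ball, so [G] bounds its product with [g]. *)
have gq1 : dotv g q1 <= enorm q1 * G.
  have [N0|N0] := eqVneq (enorm q1) 0.
    by move/eqP: (N0); rewrite enorm_eq0 => /eqP ->;
      rewrite dotvC dot0v mulr_ge0// enorm_ge0.
  rewrite -(ler_pM2l (_ : 0 < (enorm q1)^-1)); last first.
    by rewrite invr_gt0 lt_neqAle eq_sym N0 enorm_ge0.
  rewrite mulKf// -dotvZr dotvC GP//; split; last exact: enorm_unit_ball.
  by apply: conic_hullZ => //; rewrite invr_ge0 enorm_ge0.
have q2a : enorm q2 <= alpha.
  have [u /= u1 <-] := Q2a _ Q2q2; rewrite enormZ ger0_norm//.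
  by rewrite ler_piMr.
have wq1 := dotv_le_enorm w q1.
rewrite -[dotv q1 q1]sqr_enorm => var.
have N0 := enorm_ge0 q1; have W0 := enorm_ge0 w.
(* The variational inequality now reads [enorm q1 ^+ 2 <= dotv w q1 + s * dotv g q1]; divide it by
   [enorm q1]. *)
have q1le : enorm q1 <= enorm w + s * G.
  move: N0; rewrite le_eqVlt => /predU1P[<-|N0]; first by rewrite addr_ge0// mulr_ge0.
  rewrite -(ler_pM2r N0); have := ler_wpM2l s0 gq1; nra.
have sqr_sub : enorm (w - (q1 + q2)) ^+ 2 <=
    2 * enorm w ^+ 2 + 2 * (enorm q1 ^+ 2 + enorm q2 ^+ 2).
  rewrite (le_trans (sqr_enormB_le _ _))// !sqr_enorm dotvDl !dotvDr.
  by rewrite (dotvC q2 q1) (orth q1 q2)// addr0 add0r.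
have q1sqr : enorm q1 ^+ 2 <= (enorm w + s * G) ^+ 2.
  by rewrite ler_sqr ?nnegrE// addr_ge0// mulr_ge0.
have q2sqr : enorm q2 ^+ 2 <= alpha ^+ 2 by rewrite ler_sqr ?nnegrE// enorm_ge0.
(* Since [(enorm w + s * G) ^+ 2] is at most twice the sum of the squares, the coefficients are 2 +
   4 for [enorm w ^+ 2], 4 for [(s * G) ^+ 2] and 2 for [alpha ^+ 2], all at most 6. *)
have := sqr_ge0 (enorm w - s * G); have := sqr_ge0 (s * G); have := sqr_ge0 alpha.
by rewrite -exprMn; nra.
Qed.

End deterministic_bound.

(** * Convolution of normal laws on the line *)

Section gaussian_line.
Context {R : realType}.
Local Notation mu := (@lebesgue_measure R).
Local Notation N01 := (@normal_prob R 0 1).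
Implicit Types (f : R -> \bar R) (a b c m s : R).

(** The Radon-Nikodym derivative and [normal_pdf] have the same integral over every measurable set,
    hence agree almost everywhere. *)
Lemma ge0_integral_normal_prob m s f : measurable_fun [set: R] f ->
  (forall x, 0 <= f x)%E ->
  (\int[normal_prob m s]_x f x = \int[mu]_x (f x * (normal_pdf m s x)%:E))%E.
Proof.
move=> mf f0; have numu := @normal_prob_dominates R m s.
rewrite -(Radon_Nikodym_SigmaFinite.change_of_variables numu)//.
have mpdf : measurable_fun setT (fun x => (normal_pdf m s x)%:E).
  by apply/measurable_EFinP; exact: measurable_normal_pdf.
have mRN := measurable_int _ (Radon_Nikodym_SigmaFinite.f_integrable numu).
apply: ge0_ae_eq_integral => //.
- exact: emeasurable_funM.
- exact: emeasurable_funM.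
- by move=> x _; rewrite mule_ge0// Radon_Nikodym_SigmaFinite.f_ge0.
- by move=> x _; rewrite mule_ge0// lee_fin normal_pdf_ge0.
have : ae_eq mu setT (Radon_Nikodym_SigmaFinite.f (normal_prob m s) mu)
    (fun x => (normal_pdf m s x)%:E).
  apply: integral_ae_eq => // [|E _ mE].
    exact: Radon_Nikodym_SigmaFinite.f_integrable.
  by rewrite -Radon_Nikodym_SigmaFinite.f_integral.
by apply: filterS => x h _; rewrite h.
Qed.

(** The pushforward of Lebesgue measure under the affine map, scaled by [b], gives each interval its
    length, so it is Lebesgue measure by uniqueness. *)
Lemma ge0_integral_affine b m f : 0 < b -> measurable_fun [set: R] f ->
  (forall x, 0 <= f x)%E ->
  (\int[mu]_x f x = b%:E * \int[mu]_x f (b * x + m)%R)%E.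
Proof.
move=> b0 mf f0.
have mphi : measurable_fun setT
    (fun x : measurableTypeR R => b * x + m : measurableTypeR R).
  by apply: measurable_funD => //; exact: measurable_funM.
pose nu : {measure set (measurableTypeR R) -> \bar R} :=
  mscale (NngNum (ltW b0))
    (measure_function_pushforward__canonical__measure_function_Measure mu mphi).
rewrite (eq_measure_integral nu) => [|A mA _]; last first.
  apply: lebesgue_measure_unique => // _ [[c d]] _ <-.
  change (mu `]c, d] = b%:E * mu ((fun x : R => b * x + m)%R @^-1` `]c, d]))%E.
  have -> : (fun x : R => b * x + m) @^-1` [set` `]c, d]] =
      [set` `](c - m) / b, (d - m) / b]].
    apply/seteqP; split => x /=; rewrite !in_itv/=
      ltr_pdivrMr// ler_pdivlMr// ltrBlDr lerBrDr mulrC//.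
  rewrite !lebesgue_measure_itv/= !lte_fin ltr_pM2r ?invr_gt0// ltrD2r.
  case: ifP => _; last by rewrite mule0.
  rewrite -!EFinB -EFinM; congr EFin; field; exact: lt0r_neq0.
rewrite ge0_integral_mscale// ge0_integral_pushforward//.
Qed.


(** Two factorisations of the joint density of [u] and [x = a * u + b * v]: the law of [u] times
    that of [x] given [u], and the law of [x] times that of [u] given [x]. The exponents agree by
    completing the square. *)
Lemma normal_pdf_conv a b u x : 0 < b -> a ^+ 2 + b ^+ 2 = 1 ->
  normal_pdf 0 1 u * (b^-1 * normal_pdf 0 1 ((x - a * u) / b)) =
  normal_pdf 0 1 x * normal_pdf (a * x) b u.
Proof.
move=> b0 ab; have b_neq0 := lt0r_neq0 b0.
rewrite !normal_pdfE ?oner_neq0// /normal_peak /normal_fun !subr0.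
rewrite (_ : Num.sqrt (b ^+ 2 * pi *+ 2) = b * Num.sqrt (1 ^+ 2 * pi *+ 2)); last first.
  by rewrite -mulrnAr sqrtrM ?sqr_ge0// sqrtr_sqr gtr0_norm// expr1n mul1r.
rewrite invfM; set k := (Num.sqrt _)^-1.
have E : expR (- u ^+ 2 / (1 ^+ 2 *+ 2)) *
      expR (- ((x - a * u) / b) ^+ 2 / (1 ^+ 2 *+ 2)) =
    expR (- x ^+ 2 / (1 ^+ 2 *+ 2)) * expR (- (u - a * x) ^+ 2 / (b ^+ 2 *+ 2)).
  rewrite -!expRD; congr expR.
  have -> : (b ^+ 2 *+ 2)%R = 2 * b ^+ 2 by rewrite mulr_natl.
  rewrite expr1n !mulr2n.
  have a2 : a ^+ 2 = 1 - b ^+ 2 by rewrite -ab addrK.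
  field: a2.
  by rewrite b_neq0.
transitivity (b^-1 * k * k * (expR (- u ^+ 2 / (1 ^+ 2 *+ 2)) *
    expR (- ((x - a * u) / b) ^+ 2 / (1 ^+ 2 *+ 2)))); first ring.
rewrite E; ring.
Qed.

Lemma integral_normal_conv1 a b f : 0 < b -> a ^+ 2 + b ^+ 2 = 1 ->
  measurable_fun [set: R] f -> (forall x, 0 <= f x)%E ->
  (\int[N01]_u \int[N01]_v f (a * u + b * v)%R = \int[N01]_x f x)%E.
Proof.
move=> b0 ab mf f0; have b_neq0 := lt0r_neq0 b0.
have mpdf : measurable_fun [set: R] (normal_pdf 0 1 : R -> R).
  exact: measurable_normal_pdf.
pose k u x := (b^-1 * normal_pdf 0 1 ((x - a * u) / b))%R.
have k0 u x : 0 <= k u x by rewrite mulr_ge0 ?invr_ge0 ?(ltW b0) ?normal_pdf_ge0.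
have mk : measurable_fun [set: R * R] (fun z => k z.1 z.2).
  apply: measurable_funM => //; apply: measurableT_comp => //.
  apply: measurable_funM => //; apply: measurable_funB => //.
  exact: measurable_funM.
have mfk : measurable_fun [set: R * R] (fun z => f z.2 * (k z.1 z.2)%:E)%E.
  apply: emeasurable_funM; first exact: measurableT_comp.
  exact/measurable_EFinP.
have mfku u : measurable_fun [set: R] (fun x => f x * (k u x)%:E)%E.
  exact: (measurableT_comp mfk (measurable_pair1 u)).
have maff u : measurable_fun [set: R] (fun v => b * v + a * u).
  by apply: measurable_funD => //; exact: measurable_funM.
have innerE u : (\int[N01]_v f (a * u + b * v)%R = \int[mu]_x (f x * (k u x)%:E))%E.
  rewrite ge0_integral_normal_prob//; last first.
    apply: measurableT_comp => //; apply: measurable_funD => //; exact: measurable_funM.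
  rewrite [RHS](ge0_integral_affine b (a * u))//; last first.
    by move=> x; rewrite mule_ge0// lee_fin.
  rewrite -ge0_integralZl//; last 3 first.
    - exact: (measurableT_comp (mfku u) (maff u)).
    - by move=> x _; rewrite mule_ge0// lee_fin.
    - by rewrite lee_fin ltW.
  apply: eq_integral => v _.
  rewrite muleCA -EFinM /k addrK mulrA divff// mul1r mulrAC divff// mul1r.
  by rewrite addrC.
under eq_integral do rewrite innerE.
rewrite !ge0_integral_normal_prob//; last 2 first.
  - apply: (measurable_fun_fubini_tonelli_F (m2 := mu) _ mfk) => z.
    by rewrite mule_ge0// lee_fin.
  - by move=> x; apply: integral_ge0 => y _; rewrite mule_ge0// lee_fin.
transitivity (\int[mu]_u \int[mu]_x
    (f x * (normal_pdf 0 1 x * normal_pdf (a * x) b u)%:E))%E.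
  apply: eq_integral => u _; rewrite -ge0_integralZr//; last 3 first.
  - exact: mfku.
  - by move=> x _; rewrite mule_ge0// lee_fin.
  - by rewrite lee_fin normal_pdf_ge0.
  by apply: eq_integral => x _; rewrite -muleA -EFinM -normal_pdf_conv// mulrC.
have mfg : measurable_fun [set: R * R] (fun z =>
    f z.2 * (normal_pdf 0 1 z.2 * normal_pdf (a * z.2) b z.1)%:E)%E.
  under eq_fun do rewrite -normal_pdf_conv//.
  apply: emeasurable_funM; first exact: measurableT_comp.
  apply/measurable_EFinP; apply: measurable_funM => //; exact: measurableT_comp.
have fg0 z : (0 <= f z.2 * (normal_pdf 0 1 z.2 * normal_pdf (a * z.2) b z.1)%:E)%E.
  by rewrite mule_ge0// lee_fin mulr_ge0 ?normal_pdf_ge0.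
rewrite [LHS](fubini_tonelli (m1 := mu) (m2 := mu) _ mfg fg0) /=.
apply: eq_integral => x _.
under eq_integral do rewrite EFinM muleA.
rewrite ge0_integralZl//.
- by rewrite integral_normal_pdf mule1.
- by apply/measurable_EFinP; exact: measurable_normal_pdf.
- by move=> y _; rewrite lee_fin normal_pdf_ge0.
- by rewrite mule_ge0// lee_fin normal_pdf_ge0.
Qed.

(** Reduction to [c = 1] by dividing [a] and [b] by [c]. The value [a = 0] is allowed, which is what
    the first step of the partial sums uses. *)
Lemma integral_normal_conv a b c f : 0 < b -> 0 < c -> a ^+ 2 + b ^+ 2 = c ^+ 2 ->
  measurable_fun [set: R] f -> (forall x, 0 <= f x)%E ->
  (\int[N01]_u \int[N01]_v f (a * u + b * v)%R = \int[N01]_x f (c * x)%R)%E.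
Proof.
move=> b0 c0 ab mf f0.
rewrite -(@integral_normal_conv1 (a / c) (b / c) (fun x => f (c * x)%R))//.
- apply: eq_integral => u _; apply: eq_integral => v _; congr f.
  by field; exact: lt0r_neq0.
- exact: divr_gt0.
- by rewrite !expr_div_n -mulrDl ab divff// sqrf_eq0 lt0r_neq0.
- by apply: measurableT_comp => //; exact: measurable_funM.
Qed.

End gaussian_line.

(** * Tonelli's theorem for curried integrands *)

Section probability_fubini.
Context d1 d2 (T1 : measurableType d1) (T2 : measurableType d2) {R : realType}.
Variables (P1 : probability T1 R) (P2 : probability T2 R).
Variable f : T1 -> T2 -> \bar R.
Hypothesis mf : measurable_fun [set: T1 * T2] (fun z => f z.1 z.2).
Hypothesis f0 : forall x y, (0 <= f x y)%E.

Lemma measurable_fun_integral_snd :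
  measurable_fun [set: T1] (fun x => \int[P2]_y f x y)%E.
Proof. by apply: (measurable_fun_fubini_tonelli_F (m2 := P2) _ mf) => z. Qed.

Lemma probability_fubini_tonelli :
  (\int[P1]_x \int[P2]_y f x y = \int[P2]_y \int[P1]_x f x y)%E.
Proof.
exact: (fubini_tonelli (m1 := P1) (m2 := P2) _ mf (fun z => f0 z.1 z.2)).
Qed.

End probability_fubini.

(** * Convolution of Gaussian vectors *)

Section gaussian_row.
Context {R : realType}.
Implicit Types (a b c : R) (n : nat).
Local Notation N01 := (@normal_prob R 0 1).
Local Notation gauss := (@std_gaussian R).

Lemma measurable_row_lincomb n a b :
  measurable_fun [set: 'rV[R]_n * 'rV[R]_n] (fun z => a *: z.1 + b *: z.2).
Proof.
apply: measurable_fun_rowP => i.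
rewrite (_ : _ \o _ = fun z : 'rV[R]_n * 'rV[R]_n =>
    a * row_coord i z.1 + b * row_coord i z.2); last first.
  by apply/funext => z; rewrite /row_coord/= !mxE.
by apply: measurable_funD; apply: measurable_funM => //;
  apply: measurableT_comp => //; exact: measurable_row_coord.
Qed.

Lemma measurable_row_scale n a :
  measurable_fun [set: 'rV[R]_n] (fun x => a *: x).
Proof.
apply: measurable_fun_rowP => i.
rewrite (_ : _ \o _ = fun z => a * row_coord i z); last first.
  by apply/funext => z; rewrite /row_coord/= !mxE.
by apply: measurable_funM => //; exact: measurable_row_coord.
Qed.

Lemma measurable_row_sum d (T : measurableType d) n (I : finType)
    (A : pred I) (f : I -> T -> 'rV[R]_n) :
  (forall i, measurable_fun [set: T] (f i)) ->
  measurable_fun [set: T] (fun t => \sum_(i | A i) f i t).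
Proof.
move=> mf; apply: measurable_fun_rowP => j.
rewrite (_ : _ \o _ = fun t =>
    \sum_i if A i then row_coord j (f i t) else 0); last first.
  by apply/funext => t; rewrite /row_coord/= summxE big_mkcond.
apply: measurable_sum => i; case: (A i) => //.
by apply: measurableT_comp => //; exact: measurable_row_coord.
Qed.

Lemma row_cons_lincomb n a b (x y : R) (u v : 'rV[R]_n) :
  a *: row_cons (x, u) + b *: row_cons (y, v) =
  row_cons (a * x + b * y, a *: u + b *: v).
Proof. by apply/rowP => i; rewrite !mxE; case: unlift => [j|]; rewrite ?mxE. Qed.

Lemma row_consZ n c (x : R) (u : 'rV[R]_n) :
  c *: row_cons (x, u) = row_cons (c * x, c *: u).
Proof. by apply/rowP => i; rewrite !mxE; case: unlift => [j|]; rewrite ?mxE. Qed.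

Lemma ge0_integral_std_gaussianS n (f : 'rV[R]_n.+1 -> \bar R) :
  measurable_fun [set: 'rV[R]_n.+1] f -> (forall x, 0 <= f x)%E ->
  (\int[gauss n.+1]_x f x = \int[N01]_x \int[gauss n]_u f (row_cons (x, u)))%E.
Proof.
move=> mf f0; rewrite /= (ge0_integral_pushforward (@measurable_row_cons R n))//.
rewrite preimage_setT (fubini_tonelli1 (f \o @row_cons R n))//.
  by apply: measurableT_comp => //; exact: measurable_row_cons.
by move=> z; exact: f0.
Qed.

(** Induction on the dimension: split off the first coordinates, let the induction hypothesis merge
    the two tails and the one-dimensional convolution merge the two heads. *)
Lemma integral_std_gaussian_conv n a b c (f : 'rV[R]_n -> \bar R) :
  0 < b -> 0 < c -> a ^+ 2 + b ^+ 2 = c ^+ 2 ->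
  measurable_fun [set: 'rV[R]_n] f -> (forall x, 0 <= f x)%E ->
  (\int[gauss n]_u \int[gauss n]_v f (a *: u + b *: v)%R =
   \int[gauss n]_x f (c *: x)%R)%E.
Proof.
move=> b0 c0 ab; elim: n f => [|n IH] f mf f0.
  (* In dimension 0 the only row is 0, and both sides equal [f 0]. *)
  have fE x : f x = f 0 by rewrite (thinmx0 x).
  have cstE g : (forall x, g x = f 0) -> (\int[gauss 0]_u g u = f 0%R)%E.
    move=> gE; under eq_integral do rewrite gE.
    by rewrite integral_cst// [X in (_ * X)%E](probability_setT (gauss 0)) mule1.
  by rewrite !cstE// => x; rewrite cstE.
have mlin := @measurable_row_lincomb.
have mcons := @measurable_row_cons R n.
rewrite ge0_integral_std_gaussianS//; first last.
- by move=> u; apply: integral_ge0 => v _; exact: f0.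
- apply: measurable_fun_integral_snd => [|u v]; last exact: f0.
  exact: (measurableT_comp mf (mlin _ _ _)).
pose h x u y v := f (row_cons (a * x + b * y, a *: u + b *: v)).
have mh x : measurable_fun [set: ('rV[R]_n * R) * 'rV[R]_n]
    (fun z => h x z.1.1 z.1.2 z.2).
  apply: (measurableT_comp mf); apply: (measurableT_comp mcons).
  apply: measurable_fun_pair => /=.
    apply: measurable_funD => //; apply: measurable_funM => //.
    exact: measurableT_comp.
  apply: (measurableT_comp (mlin n a b)
    (_ : measurable_fun _ (fun z : ('rV[R]_n * R) * 'rV[R]_n => (z.1.1, z.2)))).
  by apply: measurable_fun_pair => //=; exact: measurableT_comp.
have mf_cons t : measurable_fun [set: 'rV[R]_n] (fun u => f (row_cons (t, u))).
  exact: (measurableT_comp (measurableT_comp mf mcons) (measurable_pair1 t)).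
pose H t := (\int[gauss n]_w f (row_cons (t, c *: w)%R))%E.
have mH : measurable_fun [set: R] H.
  apply: measurable_fun_integral_snd => [|u v]; last exact: f0.
  apply: (measurableT_comp mf); apply: (measurableT_comp mcons).
  apply: measurable_fun_pair => //=.
  by apply: (measurableT_comp (measurable_row_scale n c)).
transitivity (\int[N01]_x \int[N01]_y H (a * x + b * y)%R)%E.
  apply: eq_integral => x _.
  (* Moving the head [y] outside the tail [u] leaves the tails [u] and [v] innermost, ready for the
     induction hypothesis. *)
  transitivity (\int[gauss n]_u \int[N01]_y \int[gauss n]_v h x u y v)%E.
    apply: eq_integral => u _; rewrite ge0_integral_std_gaussianS//.
      apply: eq_integral => y _; apply: eq_integral => v _.
      by rewrite row_cons_lincomb.
    apply: (measurableT_comp mf).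
    exact: (measurableT_comp (mlin n.+1 a b) (measurable_pair1 _)).
  rewrite probability_fubini_tonelli; last 2 first.
  - apply: (measurable_fun_integral_snd _ _ _ _ _
      (fun z v => h x z.1 z.2 v)) => [|u v]; last exact: f0.
    exact: mh.
  - by move=> u y; apply: integral_ge0 => v _; exact: f0.
  by apply: eq_integral => y _; rewrite /h /= (IH (fun w => f (row_cons (_, w)))).
rewrite (integral_normal_conv _ _ c)//; last first.
  by move=> x; apply: integral_ge0 => v _; exact: f0.
rewrite ge0_integral_std_gaussianS//.
  by apply: eq_integral => x _; apply: eq_integral => w _; rewrite row_consZ.
exact: (measurableT_comp mf (measurable_row_scale n.+1 c)).
Qed.

End gaussian_row.

(** * Law of the normalised sum of independent standard Gaussian vectors *)

Section sum_of_gaussians.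
Context d (T : measurableType d) {R : realType} (P : probability T R).
Variables (p n : nat) (Z : 'I_n -> T -> 'rV[R]_p).
Local Notation gauss := (@std_gaussian R p).
Hypothesis mZ : forall i, measurable_fun [set: T] (Z i).
Hypothesis PZ : forall B : 'I_n -> set 'rV[R]_p, (forall i, measurable (B i)) ->
  P (\bigcap_i Z i @^-1` B i) = (\prod_(i < n) gauss (B i))%E.

Let S k t : 'rV[R]_p := \sum_(i < n | (i < k)%N) Z i t.

Let mS k : measurable_fun [set: T] (S k).
Proof. exact: measurable_row_sum. Qed.

Let mE (B : 'I_n -> set 'rV[R]_p) : (forall i, measurable (B i)) ->
  measurable (\bigcap_i Z i @^-1` B i).
Proof.
move=> mB; apply: fin_bigcap_measurable => // i _.
by rewrite -[_ @^-1` _]setTI; exact: mZ.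
Qed.

Lemma measurable_preimage_scale a (A : set 'rV[R]_p) : measurable A ->
  measurable ((fun x : 'rV[R]_p => a *: x) @^-1` A).
Proof. by move=> mA; rewrite -[_ @^-1` _]setTI; exact: measurable_row_scale. Qed.

(** The events [B i] with [k <= i] carry along the independence of [S k] from the remaining
    summands, so that the next summand can be added in the induction. *)
Lemma partial_sum_law k A (B : 'I_n -> set 'rV[R]_p) : (k <= n)%N ->
  measurable A -> (forall i, measurable (B i)) ->
  (forall i : 'I_n, (i < k)%N -> B i = setT) ->
  (P (S k @^-1` A `&` \bigcap_i Z i @^-1` B i) =
   gauss ((fun x => Num.sqrt k%:R *: x) @^-1` A) * \prod_(i < n) gauss (B i))%E.
Proof.
elim: k A B => [|k IH] A B kn mA mB BT.
  have S0 t : S 0 t = 0 by rewrite /S big_pred0.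
  (* Both [S 0] and scaling by [Num.sqrt 0] are constantly 0, so only membership of 0 in [A]
     matters. *)
  rewrite -PZ//; have [A0|A0] := pselect (A 0).
    rewrite (_ : S 0 @^-1` A = setT) ?setTI; last first.
      by apply/seteqP; split => t //= _; rewrite S0.
    rewrite (_ : _ @^-1` A = setT) ?probability_setT ?mul1e//.
    by apply/seteqP; split => x //= _; rewrite sqrtr0 scale0r.
  rewrite (_ : S 0 @^-1` A = set0) ?set0I ?measure0; last first.
    by apply/seteqP; split => t //=; rewrite S0.
  rewrite (_ : _ @^-1` A = set0) ?measure0 ?mul0e//.
  by apply/seteqP; split => x //=; rewrite sqrtr0 scale0r.
pose i0 := Ordinal kn.
have SS t : S k.+1 t = S k t + Z i0 t.
  rewrite /S [LHS](bigD1 i0)//= addrC; congr (_ + _).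
  by apply: eq_bigl => i; rewrite ltnS ltn_neqAle andbC.
(* The product as a nonnegative real, to serve as the total mass of [m2]. *)
pose c := fine (\prod_(i < n) gauss (B i))%E.
have cE : (\prod_(i < n) gauss (B i) = c%:E)%E.
  rewrite fineK//; apply: prode_fin_num => i _; exact: fin_num_measure.
have c0 : 0 <= c by rewrite fine_ge0// prode_ge0.
(* The restriction of [P] to [E] has joint law [m1 \x m2] under
   [(S k, Z i0)], since both agree on rectangles. *)
pose E := \bigcap_i Z i @^-1` B i.
pose SZ t := (S k t, Z i0 t).
have mSZ : measurable_fun [set: T] SZ by exact: measurable_fun_pair.
pose m' : {measure set ('rV[R]_p * 'rV[R]_p) -> \bar R} :=
  measure_function_pushforward__canonical__measure_function_Measure
    (mrestr P (mE B mB)) mSZ.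
have mk := measurable_row_scale p (Num.sqrt k%:R : R).
pose scale_k : {mfun 'rV[R]_p >-> 'rV[R]_p} :=
  HB.pack (fun x : 'rV[R]_p => Num.sqrt k%:R *: x) (isMeasurableFun.Build _ _ _ _ _ mk).
pose m1 := distribution gauss scale_k.
pose m2 := mscale (NngNum c0) gauss.
pose X := [set z : 'rV[R]_p * 'rV[R]_p | A (z.1 + z.2)].
have mX : measurable X.
  rewrite (_ : X = (fun z => 1 *: z.1 + 1 *: z.2) @^-1` A); last first.
    by apply/seteqP; split => z; rewrite /X/= !scale1r.
  by rewrite -[_ @^-1` _]setTI; exact: measurable_row_lincomb.
have m'X : m' X = P (S k.+1 @^-1` A `&` E).
  by congr (P (_ `&` _)); apply/seteqP; split => t; rewrite /= SS.
(* The induction hypothesis, applied after replacing [B i0], which is [setT], by [B']: the factor at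
   [i0] changes from 1 to [gauss B']. *)
have rect A' B' : measurable A' -> measurable B' ->
    m' (A' `*` B') = (m1 A' * m2 B')%E.
  move=> mA' mB'; pose B0 i := if i == i0 then B' else B i.
  transitivity (P (S k @^-1` A' `&` \bigcap_i Z i @^-1` B0 i)).
    congr (P _); apply/seteqP; split => [t [[/= At Bt] Et]|t [At Et]].
      split => // i _; rewrite /B0/=.
      by case: eqP => [->|_]; [exact: Bt|exact: Et].
    have B't : B' (Z i0 t) by have := Et i0 Logic.I; rewrite /B0 /= eqxx.
    split => // i _; have := Et i Logic.I; rewrite /B0 /=.
    by case: eqP => [->|//]; rewrite BT.
  rewrite IH//; last 3 first.
  - exact: ltnW.
  - by move=> i; rewrite /B0; case: eqP.
  - move=> i ik; rewrite /B0 ifF ?BT//; first by rewrite ltnS ltnW.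
    by apply/eqP => ii0; move: ik; rewrite ii0 ltnn.
  congr (_ * _)%E; rewrite /m2 /mscale/= -cE muleC (bigD1 i0)//= /B0 eqxx.
  rewrite [in RHS](bigD1 i0)//= BT// probability_setT mul1e.
  congr (_ * _)%E; apply: eq_bigr => i ii0.
  by rewrite (negPf ii0).
rewrite -[LHS]m'X -(product_measure_unique rect mX) cE.
pose f (x : 'rV[R]_p) : \bar R := (\1_A x)%:E.
have mf : measurable_fun [set: 'rV[R]_p] f.
  by apply/measurable_EFinP; exact: measurable_indic.
have mfk : measurable_fun [set: 'rV[R]_p * 'rV[R]_p]
    (fun z => f (z.1 + z.2)%R).
  apply: (measurableT_comp mf).
  have := measurable_row_lincomb p (1 : R) 1.
  by under eq_fun do rewrite !scale1r.
have f0 x : (0 <= f x)%E by rewrite lee_fin.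
transitivity (\int[(m1 \x m2)%E]_z f (z.1 + z.2)%R)%E.
  by rewrite -[in LHS](setIT X) -integral_indic.
rewrite fubini_tonelli1// /fubini_F/=.
have mfku u : measurable_fun [set: 'rV[R]_p] (fun v => f (u + v)%R).
  exact: (measurableT_comp mfk (measurable_pair1 u)).
have mF : measurable_fun [set: 'rV[R]_p] (fun u => \int[gauss]_v f (u + v)%R)%E.
  by apply: measurable_fun_integral_snd => // u v; exact: f0.
under eq_integral do rewrite ge0_integral_mscale//=.
rewrite ge0_integral_distribution//; last 2 first.
- by apply: measurable_funeM => //; exact: mF.
- by move=> u; rewrite mule_ge0// integral_ge0.
rewrite ge0_integralZl_EFin//; last 2 first.
- by move=> u _; rewrite integral_ge0.
- exact: (measurableT_comp mF mk).
rewrite muleC; congr (_ * _)%E.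
(* Convolution with coefficients [Num.sqrt k] and 1, whose squares add up to [k + 1]. *)
transitivity (\int[gauss]_x f (Num.sqrt k.+1%:R *: x)%R)%E.
  rewrite -(integral_std_gaussian_conv _ (Num.sqrt k%:R) 1)//.
  - by apply: eq_integral => u _; apply: eq_integral => v _; rewrite scale1r.
  - by rewrite !sqr_sqrtr// expr1n natr1.
rewrite -[in RHS](setIT (_ @^-1` A)) -integral_indic//.
exact: measurable_preimage_scale.
Qed.

(** The case [k = n] of the partial sums with all side events trivial, up to rescaling [A]. *)
Lemma normalized_sum_law A : (0 < n)%N -> measurable A ->
  P ((fun t => (Num.sqrt n%:R)^-1 *: \sum_(i < n) Z i t) @^-1` A) = gauss A.
Proof.
move=> n0 mA; have sn0 : Num.sqrt n%:R != 0 :> R by rewrite sqrtr_eq0 -ltNge ltr0n.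
have := partial_sum_law n _ (fun=> setT) (leqnn n)
  (measurable_preimage_scale (Num.sqrt n%:R)^-1 _ mA) (fun=> measurableT).
rewrite big1 ?mule1 => [h|i _]; last exact: probability_setT.
rewrite -[RHS](_ : gauss ((fun x => Num.sqrt n%:R *: x) @^-1`
    ((fun x => (Num.sqrt n%:R)^-1 *: x) @^-1` A)) = _); last first.
  by congr (gauss _); apply/seteqP; split => x; rewrite /= scalerA mulVf ?scale1r.
rewrite -h//; congr (P _); apply/seteqP; split => [t At|t [+ _]].
  split; last by [].
  by rewrite /S /=; under eq_bigl do rewrite ltn_ord.
by rewrite /S /=; under eq_bigl do rewrite ltn_ord.
Qed.

End sum_of_gaussians.

(* [integral] is a supremum over simple functions, so monotonicity on
   nonnegative functions needs no measurability. *)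
Lemma ge0_le_integral_lower d (T : measurableType d) (R : realType)
    (mu : {measure set T -> \bar R}) (f g : T -> \bar R) :
  (forall x, 0 <= f x)%E -> (forall x, f x <= g x)%E ->
  (\int[mu]_x f x <= \int[mu]_x g x)%E.
Proof.
move=> f0 fg; have g0 x : (0 <= g x)%E by exact: le_trans (fg x).
rewrite !ge0_integralTE//; apply: ereal_sup_le => _ [h hf <-].
by exists h => // x; exact: le_trans (fg x).
Qed.

(** * Measurability and finiteness of the supremum in the Gaussian complexity *)

Section measurable_open_row.
Context {R : realType} {p : nat}.

(** Balls of the sup norm are boxes, so [U] is the union of the countably many boxes with rational
    corners that it contains. *)
Lemma open_measurable_row (U : set 'rV[R]_p) : open U -> measurable U.
Proof.
move=> oU.
pose box (q : 'rV[rat]_p * 'rV[rat]_p) : set 'rV[R]_p :=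
  [set x | forall i, ratr (q.1 0 i) < x 0 i < ratr (q.2 0 i)].
have mbox q : measurable (box q).
  rewrite (_ : box q = \bigcap_i
      (row_coord i @^-1`
        (`]ratr (q.1 0 i), ratr (q.2 0 i)[%classic : set R))); last first.
    by apply/seteqP; split => [x qx i _|x qx i];
      have := qx i; rewrite /= in_itv/=; apply.
  apply: fin_bigcap_measurable => // i _.
  by rewrite -[_ @^-1` _]setTI; exact: measurable_row_coord.
rewrite (_ : U = \bigcup_q if `[< box q `<=` U >] then box q else set0).
  apply: countable_bigcupT_measurable => // q.
  by case: ifP.
apply/seteqP; split => [x Ux|x [q _]]; last first.
  by case: asboolP => // qU; exact: qU.
have [e /= e0 xeU] : exists2 e : R, 0 < e & ball x e `<=` U.
  by apply/nbhs_ballP; exact: open_nbhs_nbhs.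
have /choice[q qP] (i : 'I_p) : exists q : rat, x 0 i - e < ratr q < x 0 i.
  have /rat_in_itvoo[q] : x 0 i - e < x 0 i by rewrite ltrBlDr ltrDl.
  by rewrite in_itv; exists q.
have /choice[r rP] (i : 'I_p) : exists r : rat, x 0 i < ratr r < x 0 i + e.
  have /rat_in_itvoo[r] : x 0 i < x 0 i + e by rewrite ltrDl.
  by rewrite in_itv; exists r.
exists (\row_i q i, \row_i r i) => //.
have -> : `[< box (\row_i q i, \row_i r i) `<=` U >].
  apply/asboolP => z zqr; apply: xeU; split => // j i; rewrite ord1.
  have := zqr i; rewrite /= !mxE => /andP[qz zr].
  have /andP[eq _] := qP i; have /andP[_ re] := rP i.
  rewrite /ball/= ltr_norml; apply/andP; split; lra.
by move=> i /=; rewrite !mxE; have /andP[_ ->] := qP i; have /andP[-> _] := rP i.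
Qed.

(** Even for uncountable [D], the set where the supremum exceeds [c] is a union of open half-spaces,
    hence open. *)
Lemma measurable_sup_dotv (D : set 'rV[R]_p) :
  measurable_fun [set: 'rV[R]_p] (fun g => ereal_sup [set (dotv a g)%:E | a in D]).
Proof.
apply: (measurability _ (ErealGenOInfty.measurableE R)).
move=> /= _ [_ [c ->]] <-; rewrite setTI preimage_itvoy.
rewrite (_ : [set _ | _] = \bigcup_(a in D) (dotv a @^-1` [set` `]c, +oo[])).
  apply: open_measurable_row; apply: bigcup_open => a _.
  apply: open_comp; last exact: interval_open.
  move=> x _; have -> : dotv a = (fun x => dotv x a).
    by apply/funext => z; exact: dotvC.
  exact: continuous_dotvl.
apply/seteqP; split => [g /=|g [a Da] /=].
  move=> /ereal_sup_gt[_ [a Da <-]] ca; exists a => //=.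
  by rewrite in_itv/= andbT -lte_fin.
rewrite in_itv/= andbT -lte_fin => /lt_le_trans; apply.
by apply: ereal_sup_ubound; exists a.
Qed.

End measurable_open_row.

Section gaussian_complexity.
Context {R : realType} {p : nat}.
Implicit Types (D : set 'rV[R]_p) (g : 'rV[R]_p).

(** This makes the supremum finite and nonnegative, so that it can play the part of the real bound
    [G]. *)
Lemma sup_dotv_unit_ball D g : D 0 -> D `<=` unit_ball ->
  (0 <= ereal_sup [set (dotv a g)%:E | a in D] <= (enorm g)%:E)%E.
Proof.
move=> D0 D1; apply/andP; split.
  by apply: ereal_sup_ubound; exists 0 => //; rewrite dot0v.
apply: ge_ereal_sup => _ [a Da <-]; rewrite lee_fin.
by rewrite (le_trans (dotv_le_enorm _ _))// ler_piMl ?enorm_ge0//; exact: D1.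
Qed.

End gaussian_complexity.

(** * Taking expectations in the pathwise bound *)

Theorem proposition5 (R : realType) (p : nat)
  (S : set 'rV[R]_p) (xstar : 'rV[R]_p) (xstarS : S xstar)
  (C : set 'rV[R]_p) (C_closed : closed C) (C_convex : convex_subset C)
  (sigma : R) (sigma_gt0 : 0 < sigma) (n : nat) (n_gt0 : (0 < n)%N)
  (d : measure_display) (T : measurableType d) (P : probability T R)
  (y : 'I_n -> {RV P >-> 'rV[R]_p})
  (y_indep : mutually_independent y)
  (y_law : forall i, gaussian_observation xstar sigma (y i))
  (xtilde : 'rV[R]_p) (xtildeC : C xtilde)
  (Q1 Q2 : set 'rV[R]_p) (R1 R2 : {vspace 'rV[R]_p})
  (R1_orth_R2 : orthogonal_subspaces R1 R2)
  (Q1_sub : Q1 `<=` [set` R1]) (Q2_sub : Q2 `<=` [set` R2])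
  (C_decomp : [set c - xtilde | c in C] = [set q1 + q2 | q1 in Q1 & q2 in Q2])
  (alpha : R) (alpha_ge0 : 0 <= alpha)
  (Q2_bounded : Q2 `<=` [set alpha *: u | u in unit_ball]) :
  ('E_P[fun t => (enorm (xstar - constrained_lse C (sample_mean y t)) ^+ 2)%R] <=
   6%:E * ((sigma ^+ 2 / n%:R)%:E *
             gaussian_sq_complexity (conic_hull Q1 `&` unit_ball)
           + (enorm (xstar - xtilde) ^+ 2)%:E
           + (alpha ^+ 2)%:E))%E.
Proof.
have sigma_neq0 := lt0r_neq0 sigma_gt0.
have n_ge0 : 0 <= n%:R :> R by rewrite ler0n.
have sqrtn_neq0 : Num.sqrt n%:R != 0 :> R by rewrite sqrtr_eq0 -ltNge ltr0n.
(* Standardisation: the vectors [z (y i t)] are independent with law [std_gaussian p]. *)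
pose z (x : 'rV[R]_p) : 'rV[R]_p := sigma^-1 *: (x - xstar).
have mz : measurable_fun [set: 'rV[R]_p] z.
  apply: measurable_fun_rowP => i.
  rewrite (_ : _ \o _ = fun x : 'rV[R]_p =>
      sigma^-1 * (row_coord i x - xstar 0 i)); last first.
    by apply/funext => x; rewrite /row_coord/= !mxE.
  apply: measurable_funM => //; apply: measurable_funB => //.
  exact: measurable_row_coord.
pose Z i t := z (y i t).
have mZ i : measurable_fun [set: T] (Z i) by exact: measurableT_comp.
have PZ (B : 'I_n -> set 'rV[R]_p) : (forall i, measurable (B i)) ->
    P (\bigcap_i Z i @^-1` B i) = (\prod_(i < n) std_gaussian p (B i))%E.
  move=> mB.
  have mzB i : measurable (z @^-1` B i) by rewrite -[_ @^-1` _]setTI; exact: mz.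
  have := y_indep finset.setT (fun i => z @^-1` B i) mzB.
  rewrite (_ : [set` finset.setT] = setT); last first.
    by apply/seteqP; split => i //= _; rewrite finset.in_setT.
  move=> ->; under eq_bigl do rewrite finset.in_setT.
  apply: eq_bigr => i _; have := y_law i _ (mzB i).
  rewrite /distribution /pushforward => ->; congr (std_gaussian p _).
  apply/seteqP; split => x; rewrite /= /z addrAC subrr add0r scalerA mulVf//.
    by rewrite scale1r.
  by rewrite scale1r.
(* [W] is the standard Gaussian noise of the sample mean, which equals [xstar + s *: W t]. *)
pose W t := (Num.sqrt n%:R)^-1 *: \sum_(i < n) Z i t.
have mW : measurable_fun [set: T] W.
  apply: (measurableT_comp (measurable_row_scale p _)).
  exact: measurable_row_sum.
pose s := sigma / Num.sqrt n%:R.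
have s_ge0 : 0 <= s by rewrite divr_ge0 ?sqrtr_ge0 ?ltW.
have sE : s ^+ 2 = sigma ^+ 2 / n%:R by rewrite /s expr_div_n sqr_sqrtr.
have meanE t : sample_mean y t = xstar + s *: W t.
  rewrite /W /s /sample_mean scalerA -mulrA -invfM -expr2 sqr_sqrtr//.
  rewrite /Z /z -scaler_sumr scalerA mulrAC mulfV// mul1r sumrB scalerBr.
  rewrite sumr_const card_ord -(scaler_nat n xstar) scalerA mulVf
    ?scale1r ?pnatr_eq0 -?lt0n//.
  by rewrite addrC subrK.
set D := conic_hull Q1 `&` unit_ball.
have D0 : D 0 by split; [exact: conic_hull0|exact: unit_ball0].
have D1 : D `<=` unit_ball by move=> x [].
pose F g := ereal_sup [set (dotv a g)%:E | a in D].
have FP g : (0 <= F g <= (enorm g)%:E)%E by exact: sup_dotv_unit_ball.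
have F_ge0 g : (0 <= F g)%E by have /andP[] := FP g.
have F_fin g : F g \is a fin_num.
  by have /andP[? h] := FP g; rewrite ge0_fin_numE// (le_lt_trans h)// ltry.
have F2_ge0 g : (0 <= F g ^+ 2)%E by rewrite expe2 mule_ge0.
have mF2 : measurable_fun [set: 'rV[R]_p] (fun g => F g ^+ 2)%E.
  under eq_fun do rewrite expe2.
  by apply: emeasurable_funM; exact: measurable_sup_dotv.
rewrite -sE /gaussian_sq_complexity -/D -/(F _).
(* Since [W] has law [std_gaussian p], the complexity becomes an integral over the sample space,
   where it can be compared with the loss pointwise. *)
have -> : (\int[std_gaussian p]_g F g ^+ 2 = \int[P]_t F (W t) ^+ 2)%E.
  pose PW := measure_function_pushforward__canonical__measure_function_Measure P mW.
  rewrite (eq_measure_integral PW) => [|A mA _]; last first.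
    exact/esym/(@normalized_sum_law _ _ _ P _ _ Z mZ PZ).
  by rewrite ge0_integral_pushforward.
have bound_ge0 : (0 <= \int[P]_t F (W t) ^+ 2)%E by exact: integral_ge0.
have mF2W : measurable_fun [set: T] (fun t => F (W t) ^+ 2)%E.
  exact: (measurableT_comp mF2 mW).
pose b := enorm (xstar - xtilde) ^+ 2 + alpha ^+ 2.
have b_ge0 : 0 <= b by rewrite addr_ge0// sqr_ge0.
rewrite unlock.
(* The pathwise bound with [g = W t] and [G] the real value of [F (W t)]; only this majorant is then
   integrated term by term. *)
apply: (@le_trans _ _ (\int[P]_t (6%:E * ((s ^+ 2)%:E * F (W t) ^+ 2 + b%:E)))%E).
  apply: ge0_le_integral_lower => t; first by rewrite lee_fin sqr_ge0.
  rewrite expe2 -(fineK (F_fin (W t))) -!EFinM lee_fin meanE -expr2 /b addrA.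
  apply: (@constrained_lse_bound _ _ C Q1 Q2 R1 R2) => // a Da.
  by rewrite -lee_fin fineK//; apply: ereal_sup_ubound; exists a.
have c_ge0 t : (0 <= (s ^+ 2)%:E * F (W t) ^+ 2)%E.
  by rewrite mule_ge0// lee_fin sqr_ge0.
have mc : measurable_fun [set: T] (fun t => (s ^+ 2)%:E * F (W t) ^+ 2)%E.
  exact: measurable_funeM.
rewrite ge0_integralZl_EFin//; last 2 first.
- by move=> t _; rewrite adde_ge0// lee_fin.
- exact: emeasurable_funD.
rewrite ge0_integralD//.
rewrite ge0_integralZl_EFin//; last by rewrite sqr_ge0.
by rewrite integral_cst// [X in (b%:E * X)%E](probability_setT P) mule1
  (EFinD (enorm _ ^+ 2)) addeA.
Qed.
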